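(* Let $r$ and $n$ be integers with $r>n\ge 0$. Then \[ H_n(x)=n!\sum_{k=0}^{n}\left\{\sum_{j=0}^{k}\sum_{l=0}^{n}\frac{(r-k)!\,S_2(l+r-k,r-k)\,(-1)^{k-j}\binom{k}{j}2^l H_{n-l}(j)}{(l+r-k)!\,k!\,(n-l)!}\right\}B_k^{(r)}(x). \]
   Context: The Hermite polynomials $H_n(x)$ are defined by $e^{2xt-t^2}=\sum_{n\ge0}H_n(x)\frac{t^n}{n!}$. The Bernoulli polynomials of order $r$ are defined by $\left(\frac{t}{e^t-1}\right)^r e^{xt}=\sum_{n\ge0}B_n^{(r)}(x)\frac{t^n}{n!}$. The Stirling numbers of the second kind $S_2(l,n)$ are defined by $(e^t-1)^n=n!\sum_{l\ge n}S_2(l,n)\frac{t^l}{l!}$. *)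

(* Defs.v *)
From HB Require Import structures.
From mathcomp Require Import all_boot all_order all_algebra.
From mathcomp Require Import boolp.

Set Implicit Arguments.
Unset Strict Implicit.
Unset Printing Implicit Defensive.

Import GRing.Theory.
Local Open Scope ring_scope.

(* Formal power series in one variable t: [a n] is the coefficient of t^n. *)
Record fps (R : Type) := FPS { fps_coef :> nat -> R }.

HB.instance Definition _ (R : Type) := gen_eqMixin (fps R).
HB.instance Definition _ (R : Type) := gen_choiceMixin (fps R).

Lemma fpsP (R : Type) (a b : fps R) : (forall n, a n = b n) -> a = b.
Proof.
case: a b => [a] [b] /= eqab; congr FPS.
by apply: functional_extensionality_dep.
Qed.

Section FpsRing.
Variable R : comNzRingType.
Implicit Types a b c : fps R.

Definition fps_zero : fps R := FPS (fun _ => 0).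
Definition fps_opp a : fps R := FPS (fun n => - a n).
Definition fps_add a b : fps R := FPS (fun n => a n + b n).

Fact fps_addA : associative fps_add.
Proof. by move=> a b c; apply: fpsP => n /=; rewrite addrA. Qed.
Fact fps_addC : commutative fps_add.
Proof. by move=> a b; apply: fpsP => n /=; rewrite addrC. Qed.
Fact fps_add0 : left_id fps_zero fps_add.
Proof. by move=> a; apply: fpsP => n /=; rewrite add0r. Qed.
Fact fps_addN : left_inverse fps_zero fps_opp fps_add.
Proof. by move=> a; apply: fpsP => n /=; rewrite addNr. Qed.

HB.instance Definition _ :=
  GRing.isZmodule.Build (fps R) fps_addA fps_addC fps_add0 fps_addN.

Definition fps_const (c : R) : fps R := FPS (fun n => if n is 0 then c else 0).
Definition fps_mul a b : fps R :=
  FPS (fun n => \sum_(i < n.+1) a i * b (n - i)%N).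

Definition fps_trunc n a : {poly R} := \poly_(i < n) a i.

Fact coef_fps_mul n m a b : (m < n)%N ->
  fps_mul a b m = (fps_trunc n a * fps_trunc n b)`_m.
Proof.
move=> lt_mn; rewrite coefM /=; apply: eq_bigr => i _.
rewrite !coef_poly (leq_ltn_trans _ lt_mn) ?(leq_ltn_trans _ lt_mn) //.
- exact: leq_subr.
- by rewrite -ltnS.
Qed.

Fact fps_mulC : commutative fps_mul.
Proof.
by move=> a b; apply: fpsP => n; rewrite !(@coef_fps_mul n.+1) // mulrC.
Qed.

Fact fps_mulA : associative fps_mul.
Proof.
move=> a b c; apply: fpsP => n; rewrite !(@coef_fps_mul n.+1) //.
have trM u v w : (fps_trunc n.+1 (fps_mul u v) * w)`_n =
    (fps_trunc n.+1 u * fps_trunc n.+1 v * w)`_n.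
  rewrite !coefM; apply: eq_bigr => i _; congr (_ * _).
  by rewrite [LHS]coef_poly ltn_ord (@coef_fps_mul n.+1).
by rewrite [in LHS]mulrC trM trM [in LHS]mulrC mulrA.
Qed.

Fact fps_mul1 : left_id (fps_const 1) fps_mul.
Proof.
move=> a; apply: fpsP => n /=; rewrite big_ord_recl /= mul1r subn0.
by rewrite big1 ?addr0 // => i _; rewrite mul0r.
Qed.

Fact fps_mulDl : left_distributive fps_mul fps_add.
Proof.
move=> a b c; apply: fpsP => n /=; rewrite -big_split /=.
by apply: eq_bigr => i _; rewrite mulrDl.
Qed.

Fact fps_oner_neq0 : fps_const 1 != 0 :> fps R.
Proof.
by apply/eqP => /(congr1 (fun a : fps R => a 0%N)) /eqP; rewrite oner_eq0.
Qed.

HB.instance Definition _ := GRing.Zmodule_isComNzRing.Build (fps R)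
  fps_mulA fps_mulC fps_mul1 fps_mulDl fps_oner_neq0.

Definition fps_t : fps R := FPS (fun n => (n == 1%N)%:R).

(* The quotient [a / t], meant for [a 0 = 0]. *)
Definition fps_divt a : fps R := FPS (fun n => a n.+1).

Lemma fps0E n : (0 : fps R) n = 0. Proof. by []. Qed.
Lemma fps1E n : (1 : fps R) n = (n == 0%N)%:R. Proof. by case: n. Qed.
Lemma fpsDE a b n : (a + b) n = a n + b n. Proof. by []. Qed.
Lemma fpsNE a n : (- a) n = - a n. Proof. by []. Qed.
Lemma fpsME a b n : (a * b) n = \sum_(i < n.+1) a i * b (n - i)%N.
Proof. by []. Qed.

Lemma fps_sumE (I : Type) (s : seq I) (P : pred I) (F : I -> fps R) n :
  (\sum_(i <- s | P i) F i) n = \sum_(i <- s | P i) F i n.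
Proof. by elim/big_rec2: _ => // i x y _ <-. Qed.

Lemma fps_divtK a : a 0%N = 0 -> fps_divt a * fps_t = a.
Proof.
move=> a0; apply: fpsP => -[|n]; rewrite mulrC fpsME.
  by rewrite big_ord1 mul0r.
rewrite big_ord_recl mul0r add0r big_ord_recl /= mul1r subSS subn0.
by rewrite big1 ?addr0 // => i _; rewrite mul0r.
Qed.

Lemma fps_exp_small a k n : a 0%N = 0 -> (n < k)%N -> (a ^+ k) n = 0.
Proof.
move=> a0; elim: k n => // k IHk n lt_nk; rewrite exprS fpsME.
rewrite big_ord_recl a0 mul0r add0r big1 // => i _.
rewrite IHk ?mulr0 //; move: lt_nk; rewrite /= /bump /= add1n.
by case: n i => [[]//|n] i; rewrite subSS ltnS => /(leq_ltn_trans _) -> //;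
  exact: leq_subr.
Qed.

End FpsRing.

Section FpsUnitRing.
Variable R : comUnitRingType.
Implicit Types a b : fps R.

Definition fps_unit : pred (fps R) := fun a => a 0%N \is a GRing.unit.

(* Geometric series: [1/a = a_0^-1 * \sum_k (1 - a / a_0) ^ k]. The terms with
   [k > n] do not contribute to the coefficient of [t^n]. *)
Definition fps_geom a : fps R := FPS (fun n =>
  (a 0%N)^-1 *
  \sum_(k < n.+1) ((1 - fps_const (a 0%N)^-1 * a) ^+ k) n).

Definition fps_inv a : fps R := if fps_unit a then fps_geom a else a.

Fact fps_constM (c : R) a n : (fps_const c * a) n = c * a n.
Proof.
rewrite fpsME big_ord_recl subn0 big1 ?addr0 // => i _.
by rewrite mul0r.
Qed.

Fact fps_mulVr : {in fps_unit, left_inverse 1 fps_inv *%R}.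
Proof.
move=> a ua; rewrite /fps_inv (ua : fps_unit a).
have {}ua : a 0%N \is a GRing.unit by exact: ua.
set u := 1 - fps_const (a 0%N)^-1 * a.
have u0 : u 0%N = 0 by rewrite fpsDE fpsNE fps_constM mulVr // subrr.
have aE : a = fps_const (a 0%N) * (1 - u).
  rewrite opprB addrC subrK; apply: fpsP => n.
  by rewrite !fps_constM mulrA divrr // mul1r.
apply: fpsP => n.
pose S := \sum_(k < n.+1) u ^+ k.
have SE m : (m <= n)%N ->
    fps_geom a m = (fps_const (a 0%N)^-1 * S) m.
  move=> le_mn; rewrite fps_constM; congr (_ * _).
  rewrite fps_sumE -!(big_mkord xpredT (fun k => (u ^+ k) m)).
  rewrite [RHS](big_cat_nat (n := m.+1)) //= [X in _ = _ + X]big_nat_cond.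
  by rewrite [X in _ = _ + X]big1 ?addr0 // => k /andP[/andP[lt_mk _] _]; rewrite fps_exp_small.
have -> : (fps_geom a * a) n = (fps_const (a 0%N)^-1 * S * a) n.
  by rewrite !fpsME; apply: eq_bigr => i _; rewrite SE // -ltnS.
have geo : (1 - u) * S = 1 - u ^+ n.+1.
  have := subrXX 1 u n.+1; rewrite expr1n => ->; congr (_ * _).
  by apply: eq_bigr => i _; rewrite expr1n mul1r.
rewrite -mulrA fps_constM {2}aE mulrCA fps_constM mulrA mulVr // mul1r.
by rewrite [S * _]mulrC geo fpsDE fpsNE fps_exp_small // subr0.
Qed.

Fact fps_unitPl a b : b * a = 1 -> fps_unit a.
Proof.
move=> /(congr1 (fun c : fps R => c 0%N)); rewrite fpsME big_ord1 fps1E => ba.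
by apply/unitrP; exists (b 0%N); split=> //; rewrite mulrC.
Qed.

Fact fps_inv_out : {in [predC fps_unit], fps_inv =1 id}.
Proof. by move=> a /negbTE; rewrite /fps_inv => ua; rewrite ifF. Qed.

HB.instance Definition _ := GRing.ComNzRing_hasMulInverse.Build (fps R)
  fps_mulVr fps_unitPl fps_inv_out.

(* [\sum_k a ^ k / k!], meant for [a 0 = 0], when the terms with [k > n] do not
   contribute to the coefficient of [t^n]. *)
Definition fps_exp a : fps R :=
  FPS (fun n => \sum_(k < n.+1) (k`!%:R)^-1 * (a ^+ k) n).

(* The [c_n] such that [a = \sum_n c_n * t ^ n / n!]. *)
Definition egf_coef a n : R := n`!%:R * a n.

Lemma fps_exp0 a : fps_exp a 0%N = 1.
Proof. by rewrite /= big_ord1 expr0 fps1E mulr1 invr1. Qed.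

(* This is [t / (e^t - 1)]: both sides of the fraction are divided by [t]. *)
Definition bernoulli_fps : fps R := (fps_divt (fps_exp (fps_t R) - 1))^-1.

Lemma bernoulli_fpsP : bernoulli_fps * (fps_exp (fps_t R) - 1) = fps_t R.
Proof.
set e := fps_exp _ - 1; have e0 : e 0%N = 0.
  by rewrite fpsDE fpsNE fps_exp0 fps1E subrr.
rewrite -{1}(fps_divtK e0) mulrA /bernoulli_fps -/e mulVr ?mul1r //.
change (e 1%N \is a GRing.unit).
rewrite fpsDE fpsNE fps1E subr0 /= big_ord_recl big_ord1 expr0 fps1E mulr0.
by rewrite add0r expr1 invr1 mulr1 unitr1.
Qed.

End FpsUnitRing.

Section SpecialPolynomials.
Variable F : numFieldType.

Definition hermite (n : nat) : {poly F} :=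
  egf_coef (fps_exp (fps_const (2%:R *: 'X) * fps_t _ - fps_t _ ^+ 2)) n.

Definition bernoulli (r n : nat) : {poly F} :=
  egf_coef (bernoulli_fps _ ^+ r * fps_exp (fps_const 'X * fps_t _)) n.

(* As an element of [F]; it is [0] for [l < n] by [stirling2_small]. *)
Definition stirling2 (l n : nat) : F :=
  egf_coef ((fps_exp (fps_t F) - 1) ^+ n) l / n`!%:R.

Lemma stirling2_small l n : (l < n)%N -> stirling2 l n = 0.
Proof.
move=> lt_ln; rewrite /stirling2 /egf_coef fps_exp_small ?mulr0 ?mul0r //.
by rewrite fpsDE fpsNE fps_exp0 fps1E subrr.
Qed.

End SpecialPolynomials.

(* Main.v *)
From HB Require Import structures.
Require Import Defs.
From mathcomp Require Import all_boot all_order all_algebra.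
From mathcomp Require Import ring.

(* A power series g(t) acts on polynomials as the differential operator g(d/dx).
   With b = t/(e^t - 1) and c = b^-1 = (e^t - 1)/t one has B_k^(r) = b^r . x^k.
   Writing H_n = b^r . (c^r . H_n) and expanding q = c^r . H_n in powers of x,
   the coefficient of B_k^(r) in H_n is q^(k)(0)/k!. Now
   t^k c^r = (e^t - 1)^k c^(r-k), where (e^t - 1)^k is a k-th finite difference
   (the sum over j), the coefficients of c^(r-k) are Stirling numbers (the sum
   over l), and H_n^(l) = 2^l n!/(n-l)! H_(n-l). *)

Set Implicit Arguments.
Unset Strict Implicit.
Unset Printing Implicit Defensive.

Import GRing.Theory.
Local Open Scope ring_scope.

(** * Coefficients of powers of t and of exponentials *)

Section FpsTheory.
Variable R : comUnitRingType.
Implicit Types (a : fps R) (c : R).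

Lemma fpsMnE a m n : (a *+ m) n = a n *+ m.
Proof. by elim: m => [|m IH] //; rewrite !mulrS fpsDE IH. Qed.

Lemma fpsMtE a n : (a * fps_t R) n.+1 = a n.
Proof.
rewrite mulrC fpsME big_ord_recl mul0r add0r big_ord_recl /= mul1r subSS subn0.
by rewrite big1 ?addr0 // => i _; rewrite mul0r.
Qed.

Lemma fpsMt0 a : (a * fps_t R) 0%N = 0.
Proof. by rewrite fpsME big_ord1 mulr0. Qed.

Lemma fpsMtXE a m n : (a * fps_t R ^+ m) (n + m)%N = a n.
Proof.
elim: m => [|m IH]; first by rewrite mulr1 addn0.
by rewrite exprSr mulrA addnS fpsMtE.
Qed.

Lemma fps_tXE m n : (fps_t R ^+ m) n = (n == m)%:R.
Proof.
elim: m n => [|m IH] n; first by rewrite expr0 fps1E.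
by rewrite exprSr; case: n => [|n]; rewrite ?fpsMt0 // fpsMtE IH eqSS.
Qed.

Lemma fps_constXE c n : fps_const c ^+ n = fps_const (c ^+ n).
Proof.
elim: n => [|n IH]; first by apply: fpsP => -[].
apply: fpsP => m; rewrite exprS IH fps_constM.
by case: m => [|m] /=; rewrite ?exprS ?mulr0.
Qed.

Lemma fps_exp_constMtE c n :
  fps_exp (fps_const c * fps_t R) n = c ^+ n / n`!%:R.
Proof.
have cXE k : ((fps_const c * fps_t R) ^+ k) n = c ^+ k * (n == k)%:R.
  by rewrite exprMn fps_constXE fps_constM fps_tXE.
rewrite /= (bigD1 ord_max) //= cXE eqxx mulr1 big1 ?addr0 => [|i]; last first.
  by rewrite -(inj_eq val_inj) cXE eq_sym => /negbTE /= ->; rewrite !mulr0.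
exact: mulrC.
Qed.

Lemma fps_exp_tE n : fps_exp (fps_t R) n = n`!%:R^-1.
Proof.
have <- : fps_const 1 * fps_t R = fps_t R.
  by apply: fpsP => m; rewrite fps_constM mul1r.
by rewrite fps_exp_constMtE expr1n mul1r.
Qed.

(** The factorization e^t - 1 = c t, which turns powers of e^t - 1 into powers of c times powers of
    t. *)
Lemma fps_exp_t_subr1 :
  fps_exp (fps_t R) - 1 = fps_divt (fps_exp (fps_t R) - 1) * fps_t R.
Proof. by rewrite fps_divtK // fpsDE fpsNE fps_exp0 fps1E subrr. Qed.

Lemma divt_exp_t_unit : fps_divt (fps_exp (fps_t R) - 1) \is a GRing.unit.
Proof.
change ((fps_exp (fps_t R) - 1) 1%N \is a GRing.unit).
by rewrite fpsDE fpsNE fps1E subr0 fps_exp_tE invr1 unitr1.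
Qed.

End FpsTheory.

(** * Change of coefficient ring *)

Section FpsMap.
Variables (R S : comNzRingType) (f : {rmorphism R -> S}).

(** [bernoulli] lives over [{poly F}], whereas operators have coefficients in [F]; this map along
    [polyC] links the two. *)
Definition fps_map (a : fps R) : fps S := FPS (f \o a).

Fact fps_map_is_zmod_morphism : zmod_morphism fps_map.
Proof. by move=> a b; apply: fpsP => n; rewrite /= rmorphB. Qed.

Fact fps_map_is_monoid_morphism : monoid_morphism fps_map.
Proof.
split=> [|a b]; apply: fpsP => n.
  by case: n => [|n] /=; rewrite ?rmorph1 ?rmorph0.
rewrite /= rmorph_sum; apply: eq_bigr => i _; exact: rmorphM.
Qed.

HB.instance Definition _ :=
  GRing.isZmodMorphism.Build (fps R) (fps S) fps_map fps_map_is_zmod_morphism.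
HB.instance Definition _ :=
  GRing.isMonoidMorphism.Build (fps R) (fps S) fps_map
    fps_map_is_monoid_morphism.

End FpsMap.

(** * Differentiating generating functions in x *)

Section FpsDeriv.
Variable R : comNzRingType.
Implicit Types a b : fps {poly R}.

(* Differentiation with respect to the polynomial variable, not to [t]. *)
Definition fps_deriv a : fps {poly R} := FPS (fun n => (a n)^`()).

Lemma fps_derivM a b : fps_deriv (a * b) = fps_deriv a * b + a * fps_deriv b.
Proof.
apply: fpsP => n; rewrite fpsDE /= raddf_sum -big_split /=.
by apply: eq_bigr => i _; rewrite derivM.
Qed.

Lemma fps_derivXn a n : fps_deriv (a ^+ n.+1) = a ^+ n * fps_deriv a *+ n.+1.
Proof.
elim: n => [|n IH]; first by rewrite expr0 mul1r.
by rewrite exprS fps_derivM IH mulrnAr mulrA -exprS mulrC -mulrS.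
Qed.

End FpsDeriv.

(** * Power series as differential operators *)

Section FpsAct.
Variable F : numFieldType.
Implicit Types (g h : fps F) (p q : {poly F}).

Lemma natf_fact_neq0 n : n`!%:R != 0 :> F.
Proof. by rewrite Num.Theory.pnatr_eq0 -lt0n fact_gt0. Qed.

(** The operator g(d/dx): the sum may stop at [size p] because higher derivatives of p vanish. *)
Definition fps_act g p : {poly F} := \sum_(i < size p) g i *: p^`(i).

Lemma fps_actE N g p : (size p <= N)%N ->
  fps_act g p = \sum_(i < N) g i *: p^`(i).
Proof.
move=> le_pN; rewrite /fps_act (big_ord_widen _ (fun i => g i *: p^`(i)) le_pN).
rewrite big_mkcond; apply: eq_bigr => i _; case: ltnP => // le_pi.
by rewrite derivn_poly0 ?scaler0.
Qed.

Fact fps_act_is_linear g : linear (fps_act g).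
Proof.
move=> c p q; pose N := maxn (size p) (maxn (size q) (size (c *: p + q))).
rewrite !(@fps_actE N) ?leq_max ?leqnn ?orbT // scaler_sumr -big_split /=.
apply: eq_bigr => i _.
by rewrite derivnD derivnZ scalerDr !scalerA [g i * c]mulrC.
Qed.

HB.instance Definition _ g :=
  GRing.isLinear.Build F {poly F} {poly F} *:%R (fps_act g)
    (fps_act_is_linear g).

Lemma fps_act_suml (I : Type) (s : seq I) (P : pred I) (G : I -> fps F) p :
  fps_act (\sum_(i <- s | P i) G i) p = \sum_(i <- s | P i) fps_act (G i) p.
Proof.
rewrite /fps_act exchange_big /=; apply: eq_bigr => i _.
by rewrite fps_sumE scaler_suml.
Qed.

Lemma fps_act_constM c g p : fps_act (fps_const c * g) p = c *: fps_act g p.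
Proof.
rewrite /fps_act scaler_sumr; apply: eq_bigr => i _.
by rewrite fps_constM scalerA.
Qed.

Lemma size_derivn_le p i : (size p^`(i) <= size p)%N.
Proof.
apply/leq_sizeP => j le_pj; rewrite coef_derivn nth_default ?mul0rn //.
exact: leq_trans le_pj (leq_addl _ _).
Qed.

Lemma size_fps_act g p : (size (fps_act g p) <= size p)%N.
Proof.
apply: (leq_trans (size_sum _ _ _)); apply/bigmax_leqP => i _.
exact: leq_trans (size_scale_leq _ _) (size_derivn_le _ _).
Qed.

(** Composing the operators gives a double sum over the orders i and j; grouping by m = i + j yields
    the Cauchy product. *)
Lemma fps_actM g h p : fps_act (g * h) p = fps_act g (fps_act h p).
Proof.
set N := size p; rewrite (@fps_actE N g _ (size_fps_act h p)).
pose G i m := (g i * h (m - i)%N) *: p^`(m).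
transitivity (\sum_(m < N) \sum_(i < N | (i < m.+1)%N) G i m).
  apply: eq_bigr => m _; rewrite fpsME scaler_suml.
  exact: (big_ord_widen N (fun i => G i m)).
rewrite (exchange_big_dep xpredT) //=; apply: eq_bigr => i _.
rewrite /fps_act linear_sum scaler_sumr -/N.
rewrite -(big_mkord (fun m => (i < m.+1)%N) (G i)).
rewrite -(big_mkord xpredT (fun j => g i *: (h j *: p^`(j))^`(i))).
rewrite -(big_nat_widenl _ 0%N N xpredT (G i)) // -{1}[i : nat]add0n big_addn.
(* The terms with j at least N - i differentiate p at least N times, hence vanish. *)
rewrite [RHS](big_cat_nat (n := (N - i)%N)) ?leq_subr //=.
rewrite [X in _ = _ + X]big_nat.
rewrite [X in _ = _ + X]big1 ?addr0 => [|j /andP[le_Nj _]]; last first.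
  rewrite derivnZ /derivn -iterD [iter _ _ _]derivn_poly0 ?scaler0 //.
  by rewrite -leq_subLR.
apply: eq_bigr => j _; rewrite /G addnK derivnZ scalerA.
by rewrite /derivn -iterD addnC.
Qed.

Lemma fps_act_tX k p : fps_act (fps_t F ^+ k) p = p^`(k).
Proof.
rewrite (@fps_actE (maxn (size p) k.+1)) ?leq_maxl //.
have lt_k : (k < maxn (size p) k.+1)%N by rewrite leq_max leqnn orbT.
rewrite (bigD1 (Ordinal lt_k)) //= fps_tXE eqxx scale1r big1 ?addr0 // => i.
by rewrite -(inj_eq val_inj) fps_tXE => /negbTE /= ->; rewrite scale0r.
Qed.

Lemma fps_act1 p : fps_act 1 p = p.
Proof. exact: (fps_act_tX 0). Qed.

(** By Taylor's formula e^(d/dx) is the shift by 1; its j-th power is the shift by j. *)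
Lemma fps_act_expX j p x :
  (fps_act (fps_exp (fps_t F) ^+ j) p).[x] = p.[x + j%:R].
Proof.
elim: j x => [|j IH] x; first by rewrite fps_act1 addr0.
rewrite exprS fps_actM -addn1 natrD addrA addrAC -IH.
rewrite nderiv_taylor; last exact: mulrC.
rewrite /fps_act horner_sum; apply: eq_bigr => i _; rewrite hornerZ fps_exp_tE.
rewrite nderivn_def hornerMn expr1n mulr1 -[_.[x] *+ _]mulr_natl mulKf //.
exact: natf_fact_neq0.
Qed.

(** Binomial expansion of (E - 1)^k, where E is the unit shift. *)
Lemma fps_act_exp_subr1X k p x :
  (fps_act ((fps_exp (fps_t F) - 1) ^+ k) p).[x] =
  \sum_(j < k.+1) (-1) ^+ (k - j) * 'C(k, j)%:R * p.[x + j%:R].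
Proof.
(* Signs and binomials are recast as constant series so that they come out of the action as
   scalars. *)
have constX1 m : (-1) ^+ m = fps_const ((-1) ^+ m) :> fps F.
  rewrite -fps_constXE; congr (_ ^+ _); apply: fpsP => i.
  by rewrite fpsNE fps1E; case: i => // i; rewrite oppr0.
rewrite addrC exprDn fps_act_suml horner_sum; apply: eq_bigr => j _.
rewrite constX1 -mulrnAl.
have -> : fps_const ((-1) ^+ (k - j)) *+ 'C(k, j) =
    fps_const ((-1) ^+ (k - j) * 'C(k, j)%:R) :> fps F.
  rewrite mulr_natr; elim: 'C(k, j) => [|m IH]; apply: fpsP => -[|i] //.
    by rewrite !mulrS IH.
  by rewrite mulrS IH fpsDE /= addr0.
by rewrite fps_act_constM hornerZ fps_act_expX.
Qed.

(** Both sides are inverse to the same unit (e^t - 1)/t over [{poly F}]. *)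
Lemma fps_map_bernoulli_fps :
  fps_map (@polyC F) (bernoulli_fps F) = bernoulli_fps {poly F}.
Proof.
have cE : fps_map (@polyC F) (fps_divt (fps_exp (fps_t F) - 1)) =
    fps_divt (fps_exp (fps_t {poly F}) - 1).
  apply: fpsP => i.
  change (((fps_exp (fps_t F) - 1) i.+1)%:P =
    (fps_exp (fps_t {poly F}) - 1) i.+1).
  rewrite !fpsDE !fpsNE !fps1E !fps_exp_tE !subr0.
  by rewrite -polyCV polyC_natr.
apply: (mulIr (divt_exp_t_unit {poly F})).
rewrite /bernoulli_fps [RHS]mulVr ?divt_exp_t_unit // -[in LHS]cE.
by rewrite -(rmorphM (fps_map (@polyC F))) mulVr ?divt_exp_t_unit // rmorph1.
Qed.

(** The product with e^(xt) pairs the i-th coefficient of b^r with k!/(k - i)! x^(k - i), the i-th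
    derivative of x^k. *)
Lemma bernoulliE r k : bernoulli F r k = fps_act (bernoulli_fps F ^+ r) 'X^k.
Proof.
rewrite /bernoulli -fps_map_bernoulli_fps -(rmorphXn (fps_map (@polyC F))).
rewrite /egf_coef fpsME mulr_sumr (@fps_actE k.+1) ?size_polyXn //.
apply: eq_bigr => i _; rewrite fps_exp_constMtE /= mul_polyC -scalerAr derivnXn.
congr (_ *: _); have le_ik : (i <= k)%N by rewrite -ltnS.
(* [{poly F}] is not a field, so this cancellation is carried out on constants from [F]. *)
have factV : (k - i)`!%:R / (k - i)`!%:R = 1 :> {poly F}.
  by rewrite -polyC_natr polyCV -polyCM mulfV ?natf_fact_neq0.
by rewrite -(ffact_fact le_ik) natrM mulrCA -mulrA factV mulr1 mulr_natr.
Qed.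

(** As (e^t - 1)^m = c^m t^m, its coefficient of t^(l + m) is that of t^l in c^m. *)
Lemma stirling2E l m : m`!%:R * stirling2 F (l + m) m / (l + m)`!%:R =
  (fps_divt (fps_exp (fps_t F) - 1) ^+ m) l.
Proof.
rewrite /stirling2 /egf_coef [in LHS]fps_exp_t_subr1 exprMn fpsMtXE.
set x := fps_coef _ l; have m0 := natf_fact_neq0 m.
by rewrite [m`!%:R * _]mulrC mulfVK // mulrC mulKf ?natf_fact_neq0.
Qed.

End FpsAct.

(** * Derivatives and degrees of Hermite polynomials *)

Section Hermite.
Variable F : numFieldType.

(** Differentiating e^(2xt - t^2) in x multiplies it by 2t, which shifts the index by one. *)
Lemma deriv_hermite n : (hermite F n.+1)^`() = (2 * n.+1)%:R *: hermite F n.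
Proof.
rewrite /hermite; set a : fps {poly F} := fps_const _ * _ - _.
have Da : fps_deriv a = fps_const 2%:R * fps_t _.
  apply: fpsP => i; rewrite fps_constM.
  change ((a i)^`() = 2%:R * (i == 1%N)%:R).
  rewrite /a fpsDE fpsNE fps_constM derivB fps_tXE derivM derivZ derivX.
  have deriv_nat m : (m%:R : {poly F})^`() = 0 by rewrite -polyC_natr derivC.
  by rewrite !deriv_nat mulr0 addr0 subr0 alg_polyC polyC_natr.
have DX i : ((a ^+ i.+1) n.+1)^`() = 2%:R * (a ^+ i) n *+ i.+1.
  have -> : ((a ^+ i.+1) n.+1)^`() = fps_deriv (a ^+ i.+1) n.+1 by [].
  by rewrite fps_derivXn Da mulrA fpsMnE fpsMtE mulrC fps_constM.
have Dexp : (fps_exp a n.+1)^`() = 2%:R * fps_exp a n.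
  rewrite /= raddf_sum big_ord_recl /= mulr0 deriv0 add0r mulr_sumr.
  apply: eq_bigr => i _; rewrite -[_`!%:R]polyC_natr polyCV mul_polyC derivZ.
  rewrite DX factS natrM invfM -scalerMnr scalerMnl -mulr_natr mulrAC mulVf.
    by rewrite mul1r mulrCA -[in RHS]polyC_natr polyCV mul_polyC.
  by rewrite Num.Theory.pnatr_eq0.
rewrite /egf_coef -[_`!%:R]polyC_natr mul_polyC derivZ Dexp.
rewrite !mulr_natl !scaler_nat -!mulrnA factS; congr (_ *+ _).
by rewrite mulnA mulnC.
Qed.

(** In characteristic 0 the derivative determines all coefficients but the constant one, so the
    bound passes from [n] to [n.+1]. *)
Lemma size_hermite n : (size (hermite F n) <= n.+1)%N.
Proof.
elim: n => [|n IH].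
  by rewrite /hermite /egf_coef fps_exp0 mul1r size_poly1.
apply/leq_sizeP => -[|j] // le_nj; have := coef_deriv (hermite F n.+1) j.
rewrite deriv_hermite coefZ (leq_sizeP _ _ IH) // mulr0 => /esym/eqP.
by rewrite Num.Theory.mulrn_eq0 /= => /eqP.
Qed.

Lemma derivn_hermite n l : (l <= n)%N ->
  (hermite F n)^`(l) = (2%:R ^+ l * n`!%:R / (n - l)`!%:R) *: hermite F (n - l).
Proof.
elim: l n => [|l IH] [|n] // le_ln;
  try by rewrite subn0 mul1r divff ?scale1r ?natf_fact_neq0.
rewrite /derivn iterSr -/(derivn _ _) deriv_hermite derivnZ IH // scalerA.
congr (_ *: _); rewrite subSS natrM factS natrM exprS.
by rewrite [LHS]mulrA [_ * (_ * n`!%:R)]mulrACA.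
Qed.

End Hermite.

(** * Expansion of Hermite polynomials in Bernoulli polynomials of order r *)

Theorem theorem6 (F : numFieldType) (r n : nat) (hrn : (n < r)%N) :
  hermite F n =
  n`!%:R *: \sum_(0 <= k < n.+1)
    (\sum_(0 <= j < k.+1) \sum_(0 <= l < n.+1)
       ((r - k)`!%:R * stirling2 F (l + r - k) (r - k)
          * (-1) ^+ (k - j) * 'C(k, j)%:R * 2%:R ^+ l
          * (hermite F (n - l)).[j%:R])
       / ((l + r - k)`!%:R * k`!%:R * (n - l)`!%:R)) *: bernoulli F r k.
Proof.
set p := hermite F n; pose e := fps_exp (fps_t F) - 1; pose c := fps_divt e.
have bc : bernoulli_fps F ^+ r * c ^+ r = 1.
  by rewrite -exprMn mulVr ?expr1n // divt_exp_t_unit.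
pose q := fps_act (c ^+ r) p.
have sq : (size q <= n.+1)%N.
  exact: leq_trans (size_fps_act _ _) (size_hermite _ _).
have -> : p = fps_act (bernoulli_fps F ^+ r) q by rewrite -fps_actM bc fps_act1.
have -> : q = \sum_(0 <= k < n.+1) q`_k *: 'X^k.
  rewrite big_mkord -poly_def; apply/polyP => i; rewrite coef_poly.
  by case: ltnP => // le_ni; rewrite nth_default // (leq_trans sq).
rewrite linear_sum scaler_sumr; apply: eq_big_nat => k /andP[_ lt_kn].
rewrite linearZ /= -bernoulliE scalerA; congr (_ *: _).
have le_kr : (k <= r)%N by rewrite ltnW // (leq_ltn_trans _ hrn).
(* As a derivative at 0, the coefficient becomes accessible to the operator t^k. *)
have -> : q`_k = (q^`(k)).[0] / k`!%:R.
  rewrite horner_coef0 coef_derivn addn0 ffactnn -[_`_k *+ _]mulr_natr mulfK //.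
  exact: natf_fact_neq0.
have -> : q^`(k) = fps_act (e ^+ k) (fps_act (c ^+ (r - k)) p).
  rewrite -fps_act_tX -!fps_actM /e fps_exp_t_subr1 exprMn.
  by rewrite mulrAC -exprD subnKC // mulrC.
rewrite fps_act_exp_subr1X big_mkord mulr_suml mulr_sumr.
apply: eq_bigr => j _; rewrite add0r.
(* Truncating at [n.+1] rather than at the size of [p] gives the range of l in the statement. *)
rewrite (@fps_actE F n.+1) ?size_hermite // horner_sum big_mkord.
rewrite !(mulr_sumr, mulr_suml); apply: eq_bigr => l _.
rewrite hornerZ -stirling2E derivn_hermite -1?ltnS // hornerZ -addnBA //.
rewrite /stirling2 !invfM; ring.
Qed.
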